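(* There is a regainingly approximable number $\alpha\in(0,1)$ such that $K(\alpha\restriction n)>n$ for infinitely many $n$.
   Context: A real number $\alpha$ is regainingly approximable if there exists a computable nondecreasing sequence of rational numbers $(a_n)_n$ converging to $\alpha$ such that $\alpha-a_n<2^{-n}$ holds for infinitely many $n\in\mathbb{N}$. $K$ denotes prefix-free Kolmogorov complexity. For a real $x$, $x\restriction n$ denotes the first $n$ bits of the unique infinite binary sequence with infinitely many ones that is a binary representation of the unique $y\in(0,1]$ with $x-y\in\mathbb{Z}$. *)

(* Defs.v *)
From HB Require Import structures.
From Stdlib Require Cantor.
From mathcomp Require Import all_boot all_order all_algebra.
From mathcomp Require Import all_classical all_reals all_analysis.
Import Order.TTheory GRing.Theory Num.Theory.
Import numFieldNormedType.Exports.

Set Implicit Arguments.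
Unset Strict Implicit.
Unset Printing Implicit Defensive.

Local Open Scope classical_set_scope.
Local Open Scope ring_scope.

(** * Partial recursive functions *)

(* Programs for the partial recursive functions of one natural number argument;
   several arguments are passed through the Cantor pairing. *)
Inductive code : Type :=
| czero | csucc | cfst | csnd
| cpair of code & code
| ccomp of code & code
| cprec of code & code
| cmu of code.

Definition npair (m n : nat) : nat := Cantor.to_nat (m, n).
Definition nfst (n : nat) : nat := (Cantor.of_nat n).1.
Definition nsnd (n : nat) : nat := (Cantor.of_nat n).2.

(* [eval c n m]: the program [c] halts on input [n] with output [m].
   On input <a, k>, [cprec f g] computes h(a, k) where h(a, 0) = f(a) and
   h(a, i + 1) = g(<a, <i, h(a, i)>>).  On input n, [cmu f] returns the least m
   with f(<n, m>) = 0, provided that f halts on <n, i> for all i < m. *)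
Fixpoint eval (c : code) : nat -> nat -> Prop :=
  match c with
  | czero => fun _ m => m = 0%N
  | csucc => fun n m => m = n.+1
  | cfst => fun n m => m = nfst n
  | csnd => fun n m => m = nsnd n
  | cpair f g => fun n m =>
      exists x y, [/\ eval f n x, eval g n y & m = npair x y]
  | ccomp f g => fun n m => exists2 x, eval g n x & eval f x m
  | cprec f g => fun n =>
      (fix h (k : nat) : nat -> Prop :=
        match k with
        | 0%N => eval f (nfst n)
        | i.+1 => fun m =>
            exists2 r, h i r & eval g (npair (nfst n) (npair i r)) m
        end) (nsnd n)
  | cmu f => fun n m =>
      eval f (npair n m) 0%N /\
      forall i, (i < m)%N -> exists r, eval f (npair n i) r.+1
  end.

Definition computable (f : nat -> nat) : Prop :=
  exists c, forall n, eval c n (f n).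

Definition computable_rat_seq (a : nat -> rat) : Prop :=
  exists p q r : nat -> nat,
    [/\ computable p, computable q, computable r
      & forall n, a n = ((p n)%:R - (q n)%:R) / (r n).+1%:R].

(** * Prefix-free Kolmogorov complexity *)

(* Bijective base-2 numeration, least significant digit first: a bijection from
   binary strings onto the natural numbers. *)
Fixpoint strcode (s : seq bool) : nat :=
  if s is b :: s' then ((strcode s').*2 + b).+1 else 0%N.

(* [M s = None] means that the partial function [M] is undefined at [s]. *)
Definition partial_computable (M : seq bool -> option (seq bool)) : Prop :=
  exists c, forall s m,
    eval c (strcode s) m <-> exists2 t, M s = Some t & m = strcode t.

Definition prefix_free_machine (M : seq bool -> option (seq bool)) : Prop :=
  partial_computable M /\
  forall s s', M s <> None -> M s' <> None -> prefix s s' -> s = s'.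

Definition optimal_machine (U : seq bool -> option (seq bool)) : Prop :=
  prefix_free_machine U /\
  forall M, prefix_free_machine M ->
    exists c : nat, forall s t, M s = Some t ->
      exists2 s', U s' = Some t & (size s' <= size s + c)%N.

(* The least length of a [U]-description of [t].  Every string has one when [U]
   is optimal; the value 0 for strings without a description is a dummy. *)
Definition K (U : seq bool -> option (seq bool)) (t : seq bool) : nat :=
  xget 0%N [set k | (exists2 s, U s = Some t & size s = k) /\
                    (forall s, U s = Some t -> (k <= size s)%N)].

(** * Real numbers *)

Definition is_binary_representation (R : realType) (b : nat -> bool) (y : R) :=
  series (fun k => (b k)%:R / 2 ^+ k.+1) @ \oo --> y.

(* The binary sequence with infinitely many ones representing the y in (0, 1]
   that differs from x by an integer; exactly one sequence qualifies, so the
   default value of [xget] is never used. *)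
Definition binary_sequence (R : realType) (x : R) : nat -> bool :=
  xget (fun=> false)
    [set b : nat -> bool | infinite_set [set k | b k] /\
       exists y : R, [/\ 0 < y <= 1, x - y \is a Num.int
                       & is_binary_representation b y]].

Definition restrict_bits (R : realType) (x : R) (n : nat) : seq bool :=
  mkseq (binary_sequence x) n.

Definition regainingly_approximable (R : realType) (alpha : R) : Prop :=
  exists a : nat -> rat,
    [/\ computable_rat_seq a,
        {homo a : m n / (m <= n)%N >-> m <= n},
        (fun n => ratr (a n) : R) @ \oo --> alpha
      & infinite_set [set n | alpha - ratr (a n) < 2 ^- n]].

(* Main.v *)
(** The number alpha is built by a finite injury construction.  A block started
    at position s may use the positions below bend s = 2^(s+2), a bound so large
    that, by Kraft's inequality, the programs of a prefix-free machine cannot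
    compress all extensions of a given string of length s + 1 at all lengths n
    with s + 1 < n <= bend s.  At every stage the block holds a string not yet
    known to be compressible at all these lengths; when it becomes so, the block
    moves on to the lexicographic successor and all later blocks are cancelled.
    Hence the approximation increases, and every block that is never cancelled
    settles on a string with an incompressible prefix.

    A new block is started at a position equal to the current stage.  So when
    the last change of a block that is never cancelled happens at stage T, all
    later changes are at positions beyond T, and the approximation reached by
    then is within 2^-(T+1) of alpha: this is why alpha is regainingly
    approximable. *)

Require Import Defs.
From mathcomp Require Import all_boot all_order all_algebra.
From mathcomp Require Import all_classical all_reals all_analysis.
From mathcomp Require Import zify ring lra.
Import Order.TTheory GRing.Theory Num.Theory.
Import numFieldNormedType.Exports.
(* MathComp-Analysis shadows [code], [czero] and [eval]. *)
Import Defs.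

Set Implicit Arguments.
Unset Strict Implicit.
Unset Printing Implicit Defensive.

Local Open Scope nat_scope.

(** * Computable functions *)

Lemma nfst_pair m n : nfst (npair m n) = m.
Proof. by rewrite /nfst /npair Cantor.cancel_of_to. Qed.

Lemma nsnd_pair m n : nsnd (npair m n) = n.
Proof. by rewrite /nsnd /npair Cantor.cancel_of_to. Qed.

Lemma npair_eta n : npair (nfst n) (nsnd n) = n.
Proof. by rewrite /npair /nfst /nsnd -surjective_pairing Cantor.cancel_to_of. Qed.

Lemma computable_ext f g : f =1 g -> computable f -> computable g.
Proof. by move=> fg [c hc]; exists c => n; rewrite -fg. Qed.

Lemma computable_id : computable id.
Proof.
exists (cpair cfst csnd) => n /=; exists (nfst n), (nsnd n).
by split=> //; rewrite npair_eta.
Qed.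

Lemma computable_comp f g :
  computable f -> computable g -> computable (fun n => f (g n)).
Proof. by move=> [c hc] [d hd]; exists (ccomp c d) => n /=; exists (g n). Qed.

Lemma computable_succ f : computable f -> computable (fun n => (f n).+1).
Proof. by apply: (@computable_comp succn); exists csucc. Qed.

Lemma computable_fst f : computable f -> computable (fun n => nfst (f n)).
Proof. by apply: computable_comp; exists cfst. Qed.

Lemma computable_snd f : computable f -> computable (fun n => nsnd (f n)).
Proof. by apply: computable_comp; exists csnd. Qed.

Lemma computable_const m : computable (fun=> m).
Proof. by elim: m => [|m IH]; [exists czero | exact: computable_succ]. Qed.

Lemma computable_pair f g :
  computable f -> computable g -> computable (fun n => npair (f n) (g n)).
Proof.
by move=> [c hc] [d hd]; exists (cpair c d) => n /=; exists (f n), (g n).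
Qed.

Lemma computable_app2 F f g :
  computable (fun z => F (nfst z) (nsnd z)) -> computable f -> computable g ->
  computable (fun n => F (f n) (g n)).
Proof.
move=> hF hf hg; apply: computable_ext (computable_comp hF (computable_pair hf hg)).
by move=> n /=; rewrite nfst_pair nsnd_pair.
Qed.

Lemma computable_app3 F f g h :
  computable (fun z => F (nfst z) (nfst (nsnd z)) (nsnd (nsnd z))) ->
  computable f -> computable g -> computable h ->
  computable (fun n => F (f n) (g n) (h n)).
Proof.
move=> hF hf hg hh.
apply: computable_ext (computable_comp hF
  (computable_pair hf (computable_pair hg hh))).
by move=> n /=; rewrite !nsnd_pair !nfst_pair.
Qed.

Definition prec (a : nat) (s : nat -> nat -> nat) (k : nat) : nat :=
  nat_rect (fun=> nat) a s k.

Lemma precS a s k : prec a s k.+1 = s k (prec a s k).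
Proof. by []. Qed.

(** The step of [cprec] sees only its parameter besides index and previous value, so the parameter
    is taken to be the whole input [n]. *)
Lemma computable_prec f g k :
  computable f ->
  computable (fun z => g (nfst z) (nfst (nsnd z)) (nsnd (nsnd z))) ->
  computable k -> computable (fun n => prec (f n) (g n) (k n)).
Proof.
move=> [c hc] [d hd]; apply: (@computable_app2 (fun a => prec (f a) (g a)) id);
  last exact: computable_id.
exists (cprec c d) => z /=; elim: (nsnd z) => [|i IH]; first exact: hc.
exists (prec (f (nfst z)) (g (nfst z)) i) => //.
by have := hd (npair (nfst z) (npair i (prec (f (nfst z)) (g (nfst z)) i)));
  rewrite !nsnd_pair !nfst_pair.
Qed.

Lemma computable_pred f : computable f -> computable (fun n => (f n).-1).
Proof.
move=> hf; apply: (computable_ext (f := fun n => prec 0 (fun i _ => i) (f n))).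
  by move=> n; case: (f n).
apply: (computable_prec (g := fun _ i _ => i)) => //.
  exact: computable_const.
by do ?[exact: computable_id | apply: computable_fst | apply: computable_snd].
Qed.

Lemma computable_add f g :
  computable f -> computable g -> computable (fun n => f n + g n).
Proof.
move=> hf hg.
apply: (computable_ext (f := fun n => prec (f n) (fun _ r => r.+1) (g n))).
  by move=> n; elim: (g n) => [|i /= ->]; rewrite ?addn0 ?addnS.
apply: (computable_prec (g := fun _ _ r => r.+1)) => //.
by do ?[exact: computable_id | apply: computable_succ | apply: computable_snd].
Qed.

Lemma computable_sub f g :
  computable f -> computable g -> computable (fun n => f n - g n).
Proof.
move=> hf hg.
apply: (computable_ext (f := fun n => prec (f n) (fun _ r => r.-1) (g n))).
  by move=> n; elim: (g n) => [|i /= ->]; rewrite ?subn0 ?subnS.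
apply: (computable_prec (g := fun _ _ r => r.-1)) => //.
by do ?[exact: computable_id | apply: computable_pred | apply: computable_snd].
Qed.

Lemma computable_mul f g :
  computable f -> computable g -> computable (fun n => f n * g n).
Proof.
move=> hf hg.
apply: (computable_ext (f := fun n => prec 0 (fun _ r => r + f n) (g n))).
  by move=> n; elim: (g n) => [|i /= ->]; rewrite ?muln0 ?mulnS 1?addnC.
apply: (computable_prec (g := fun n _ r => r + f n)) => //.
  exact: computable_const.
apply: computable_add; last by apply: computable_comp => //; 
  apply: computable_fst; exact: computable_id.
by do ?[exact: computable_id | apply: computable_snd].
Qed.

Lemma computable_exp f g :
  computable f -> computable g -> computable (fun n => f n ^ g n).
Proof.
move=> hf hg.
apply: (computable_ext (f := fun n => prec 1 (fun _ r => r * f n) (g n))).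
  by move=> n; elim: (g n) => [|i /= ->]; rewrite ?expn0 ?expnSr.
apply: (computable_prec (g := fun n _ r => r * f n)) => //.
  exact: computable_const.
apply: computable_mul; last by apply: computable_comp => //; 
  apply: computable_fst; exact: computable_id.
by do ?[exact: computable_id | apply: computable_snd].
Qed.

Lemma computable_eq0 f :
  computable f -> computable (fun n => f n == 0 : nat).
Proof.
move=> hf; apply: (computable_ext (f := fun n => 1 - f n)).
  by move=> n; case: (f n) => // m; rewrite subSS sub0n.
by apply: computable_sub => //; exact: computable_const.
Qed.

Lemma computable_leq f g :
  computable f -> computable g -> computable (fun n => f n <= g n : nat).
Proof. by move=> hf hg; exact/computable_eq0/computable_sub. Qed.

Lemma computable_negb (P : pred nat) :
  computable P -> computable (fun n => ~~ P n : nat).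
Proof.
by move=> /computable_eq0; apply: computable_ext => n; case: (P n).
Qed.

Lemma computable_andb (P Q : pred nat) :
  computable P -> computable Q -> computable (fun n => P n && Q n : nat).
Proof.
move=> hP hQ; apply: computable_ext (computable_mul hP hQ) => n.
by rewrite mulnb.
Qed.

Lemma computable_implb (P Q : pred nat) :
  computable P -> computable Q -> computable (fun n => P n ==> Q n : nat).
Proof.
move=> hP hQ.
have := computable_negb (computable_andb hP (computable_negb hQ)).
by apply: computable_ext => n; case: (P n); case: (Q n).
Qed.

Lemma computable_eq f g :
  computable f -> computable g -> computable (fun n => f n == g n : nat).
Proof.
move=> hf hg; apply: (computable_ext (f := fun n => (f n <= g n) && (g n <= f n))).
  by move=> n; rewrite eqn_leq.
by apply: computable_andb; apply: computable_leq.
Qed.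

Lemma computable_if (P : pred nat) f g :
  computable P -> computable f -> computable g ->
  computable (fun n => if P n then f n else g n).
Proof.
move=> hP hf hg.
have := computable_add (computable_mul hP hf)
  (computable_mul (computable_negb hP) hg).
by apply: computable_ext => n; case: (P n); rewrite /= mul1n mul0n ?addn0.
Qed.

(** Descends through the syntax of the function; subterms with an unlisted head that are neither
    constant nor assumed computable remain as goals. *)
Ltac computability :=
  lazymatch goal with
  | |- computable (fun n => n) => exact: computable_id
  | |- computable (fun n => nfst (@?f n)) =>
      apply: (@computable_fst f); computability
  | |- computable (fun n => nsnd (@?f n)) =>
      apply: (@computable_snd f); computability
  | |- computable (fun n => npair (@?f n) (@?g n)) =>
      apply: (@computable_pair f g); computability
  | |- computable (fun n => (@?f n).+1) =>
      apply: (@computable_succ f); computability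
  | |- computable (fun n => (@?f n).-1) =>
      apply: (@computable_pred f); computability
  | |- computable (fun n => @?f n + @?g n) =>
      apply: (@computable_add f g); computability
  | |- computable (fun n => @?f n - @?g n) =>
      apply: (@computable_sub f g); computability
  | |- computable (fun n => @?f n * @?g n) =>
      apply: (@computable_mul f g); computability
  | |- computable (fun n => @?f n ^ @?g n) =>
      apply: (@computable_exp f g); computability
  | |- computable (fun n => nat_of_bool (@?f n <= @?g n)) =>
      apply: (@computable_leq f g); computability
  | |- computable (fun n => nat_of_bool (@?f n == @?g n)) =>
      apply: (@computable_eq f g); computability
  | |- computable (fun n => nat_of_bool (~~ @?f n)) =>
      apply: (@computable_negb f); computability
  | |- computable (fun n => nat_of_bool (@?f n && @?g n)) =>
      apply: (@computable_andb f g); computability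
  | |- computable (fun n => nat_of_bool (@?f n ==> @?g n)) =>
      apply: (@computable_implb f g); computability
  | |- computable (fun n => if _ then _ else _) =>
      apply: computable_if; computability
  | |- computable (fun n => prec (@?f n) (@?g n) (@?k n)) =>
      apply: (@computable_prec f g k); cbv beta; computability
  | |- computable nfst => exact: (computable_fst computable_id)
  | |- computable nsnd => exact: (computable_snd computable_id)
  | |- _ => first [exact: computable_const | assumption | idtac]
  end.

Lemma computable_mod f g :
  computable f -> computable g -> computable (fun n => f n %% g n).
Proof.
apply: (@computable_app2 modn).
(* A cyclic counter that is reset on reaching the modulus; for modulus 0 it is never reset, in
   accordance with [modn0]. *)
apply: (computable_ext (f := fun z =>
  prec 0 (fun _ r => if r.+1 == nsnd z then 0 else r.+1) (nfst z))); last first.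
  by computability.
move=> z; case: (nsnd z) (nfst z) => [|d] m.
  by rewrite modn0; elim: m => //= m ->.
elim: m => [|m /= ->]; first by rewrite mod0n.
rewrite -(addn1 m) -modnDml addn1; have := ltn_pmod m (ltn0Sn d).
rewrite leq_eqVlt => /orP[/eqP ->|lt]; first by rewrite eqxx modnn.
by rewrite [RHS]modn_small // ltn_eqF.
Qed.

Lemma computable_div f g :
  computable f -> computable g -> computable (fun n => f n %/ g n).
Proof.
apply: (@computable_app2 divn).
(* The quotient counts the multiples of the divisor among 1, ..., [nfst z]. *)
apply: (computable_ext (f := fun z =>
  prec 0 (fun i r => r + (i.+1 %% nsnd z == 0)) (nfst z))); last first.
  computability; apply: computable_mod; computability.
move=> z; case: (nsnd z) (nfst z) => [|d] m.
  by rewrite divn0; elim: m => //= m ->.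
elim: m => [|m /= ->]; first by rewrite div0n.
by rewrite (divnS m (ltn0Sn d)) addnC.
Qed.

Lemma computable_has (P : nat -> pred nat) k :
  computable (fun z => P (nfst z) (nsnd z) : nat) -> computable k ->
  computable (fun n => has (P n) (iota 0 (k n)) : nat).
Proof.
move=> hP hk; apply: (computable_ext (f := fun n =>
  prec 0 (fun i r => if P n i then 1 else r) (k n))).
  move=> n; elim: (k n) => // i IH; rewrite precS IH.
  rewrite -(addn1 i) iotaD has_cat /= orbF add0n.
  by case: (P n i); rewrite ?orbT ?orbF.
computability.
by apply: (@computable_app2 (fun a b => P a b : nat)) => //; computability.
Qed.

Lemma computable_all (P : nat -> pred nat) k :
  computable (fun z => P (nfst z) (nsnd z) : nat) -> computable k ->
  computable (fun n => all (P n) (iota 0 (k n)) : nat).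
Proof.
move=> hP hk; apply: (computable_ext (f := fun n =>
    ~~ has (fun i => ~~ P n i) (iota 0 (k n)))).
  by move=> n; rewrite -all_predC; congr (nat_of_bool _); apply: eq_all => i /=;
    rewrite negbK.
apply: computable_negb; apply: computable_has => //.
exact: computable_negb hP.
Qed.

Lemma computable_find (P : nat -> pred nat) k :
  computable (fun z => P (nfst z) (nsnd z) : nat) -> computable k ->
  computable (fun n => find (P n) (iota 0 (k n))).
Proof.
(* The equality [r == i] records that no index below [i] satisfies [P n]; only then is [i] tested,
   otherwise the index found is kept. *)
move=> hP hk; apply: (computable_ext (f := fun n =>
  prec 0 (fun i r => if r == i then i + ~~ P n i else r) (k n))).
  move=> n; elim: (k n) => // i IH; rewrite precS IH.
  rewrite -(addn1 i) iotaD find_cat size_iota has_find size_iota /=.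
  have := find_size (P n) (iota 0 i); rewrite size_iota leq_eqVlt add0n.
  case/orP=> [/eqP -> | lt]; first by rewrite ltnn eqxx; case: (P n i).
  by rewrite lt ltn_eqF.
computability.
by apply: (@computable_app2 (fun a b => P a b : nat)) => //; computability.
Qed.

(** * Simulation of programs with bounded fuel *)

(* Fuel-bounded evaluation: [0] codes "no answer yet" and [m.+1] the answer [m]. *)
Definition approximates (E : nat -> nat -> nat) (c : code) : Prop :=
  [/\ computable (fun z => E (nfst z) (nsnd z)),
      forall n m, eval c n m <-> exists k, E n k = m.+1
    & forall n m k k', k <= k' -> E n k = m.+1 -> E n k' = m.+1].

Lemma computable_approximates c f :
  computable f -> (forall n m, eval c n m <-> m = f n) ->
  approximates (fun n _ => (f n).+1) c.
Proof.
move=> hf h; split=> //.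
  by apply: computable_succ; apply: computable_comp => //; computability.
by move=> n m; rewrite h; split=> [->|[_ []]] //; exists 0.
Qed.

Lemma approximates_pair E1 E2 c1 c2 :
  approximates E1 c1 -> approximates E2 c2 ->
  approximates (fun n k => if (E1 n k == 0) then 0 else if E2 n k == 0 then 0
                 else (npair (E1 n k).-1 (E2 n k).-1).+1) (cpair c1 c2).
Proof.
move=> [p1 s1 m1] [p2 s2 m2]; split; first by computability.
  move=> n m /=; split.
    move=> [x [y [/s1 [k1 e1] /s2 [k2 e2] ->]]]; exists (maxn k1 k2).
    by rewrite (m1 _ _ _ _ (leq_maxl k1 k2) e1) (m2 _ _ _ _ (leq_maxr k1 k2) e2).
  move=> [k]; case e1: (E1 n k) => [//|x]; case e2: (E2 n k) => [//|y] /= [<-].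
  by exists x, y; split=> //; [apply/s1 | apply/s2]; exists k.
move=> n m k k' le; case e1: (E1 n k) => [//|x]; case e2: (E2 n k) => [//|y] /=.
by rewrite (m1 _ _ _ _ le e1) (m2 _ _ _ _ le e2).
Qed.

Lemma approximates_comp E1 E2 c1 c2 :
  approximates E1 c1 -> approximates E2 c2 ->
  approximates (fun n k => if E2 n k == 0 then 0 else E1 (E2 n k).-1 k)
    (ccomp c1 c2).
Proof.
move=> [p1 s1 m1] [p2 s2 m2]; split.
    by computability; apply: computable_app2 => //; computability.
  move=> n m /=; split.
    move=> [x /s2 [k2 e2] /s1 [k1 e1]]; exists (maxn k1 k2).
    by rewrite (m2 _ _ _ _ (leq_maxr k1 k2) e2) (m1 _ _ _ _ (leq_maxl k1 k2) e1).
  move=> [k]; case e2: (E2 n k) => [//|x] /= e1.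
  by exists x; [apply/s2 | apply/s1]; exists k.
move=> n m k k' le; case e2: (E2 n k) => [//|x] /= e1.
by rewrite (m2 _ _ _ _ le e2) (m1 _ _ _ _ le e1).
Qed.

Lemma approximates_prec E1 E2 c1 c2 :
  approximates E1 c1 -> approximates E2 c2 ->
  approximates (fun n k => prec (E1 (nfst n) k)
    (fun i r => if r == 0 then 0 else E2 (npair (nfst n) (npair i r.-1)) k)
    (nsnd n)) (cprec c1 c2).
Proof.
move=> [p1 s1 m1] [p2 s2 m2]; split.
- computability; first by apply: computable_app2 => //; computability.
  by apply: computable_app2 => //; computability.
- move=> n /=; elim: (nsnd n) => [|i IH] m; first exact: s1.
  split.
    move=> [r /IH [k1 e1] /s2 [k2 e2]]; exists (maxn k1 k2) => /=.
    (* The recursion up to [i] succeeded with fuel [k1]; the larger fuel preserves all its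
       intermediate answers. *)
    suff -> : prec (E1 (nfst n) (maxn k1 k2)) (fun i r => if r == 0 then 0 else
        E2 (npair (nfst n) (npair i r.-1)) (maxn k1 k2)) i = r.+1.
      by rewrite /= (m2 _ _ _ _ (leq_maxr k1 k2) e2).
    move: (leq_maxl k1 k2) e1 {e2 IH}; move: (maxn k1 k2) => k le.
    elim: i r => [|i IH] r /=; first exact: m1.
    case e: (prec _ _ i) => [//|r'] /=; rewrite (IH _ e) /=; exact: m2.
  move=> [k] /=; case e: (prec _ _ i) => [//|r] /= e2.
  by exists r; [apply/IH | apply/s2]; exists k.
- move=> n m k k' le; elim: (nsnd n) m => [|i IH] m /=; first exact: m1.
  case e: (prec _ _ i) => [//|r'] /=; rewrite (IH _ e) /=; exact: m2.
Qed.

Lemma find_iotaP (P : pred nat) m k :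
  m < k -> P m -> (forall i, i < m -> ~~ P i) -> find P (iota 0 k) = m.
Proof.
move=> mk Pm nP.
have hP : has P (iota 0 k) by apply/hasP; exists m; rewrite ?mem_iota.
have lt := hP; rewrite has_find size_iota in lt.
have := nth_find 0 hP; rewrite nth_iota // add0n => Pf.
apply/eqP; rewrite eqn_leq leqNgt [m <= _]leqNgt; apply/andP; split.
  apply/negP => h; have := before_find 0 h.
  by rewrite nth_iota ?(ltn_trans h) // add0n Pm.
by apply/negP => /nP; rewrite Pf.
Qed.

(** A value at most 1 means unanswered or answered by 0. The search stops at the first such index
    and succeeds only if the answer there is 0: an unanswered index blocks the search instead of
    being skipped, which keeps answers stable under more fuel. *)
Lemma approximates_mu E1 c1 :
  approximates E1 c1 ->
  approximates (fun n k =>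
    let m := find (fun i => E1 (npair n i) k <= 1) (iota 0 k) in
    if (m < k) && (E1 (npair n m) k == 1) then m.+1 else 0) (cmu c1).
Proof.
move=> [p1 s1 m1].
have found n k m : (let m := find (fun i => E1 (npair n i) k <= 1) (iota 0 k) in
    if (m < k) && (E1 (npair n m) k == 1) then m.+1 else 0) = m.+1 <->
  [/\ m < k, E1 (npair n m) k = 1 & forall i, i < m -> 1 < E1 (npair n i) k].
  split=> /=.
    case: ifP => // /andP[lt /eqP e] [<-]; split=> // i il.
    have := before_find 0 il; rewrite nth_iota ?(ltn_trans il) // add0n.
    by rewrite ltnNge => ->.
  move=> [mk e lt]; rewrite (@find_iotaP _ m) ?e // ?mk //.
  by move=> i /lt; rewrite -ltnNge.
split.
- rewrite /=; computability; try (apply: computable_find; first computability;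
    computability; apply: computable_app2 => //; computability).
  apply: computable_app2 => //; computability.
  apply: computable_find; computability.
  by apply: computable_app2 => //; computability.
- move=> n m; split; last first.
    move=> [k /found [mk e lt]]; split; first by apply/s1; exists k.
    move=> i /lt; case e': (E1 (npair n i) k) => [|[|r]] // _.
    by exists r; apply/s1; exists k.
  move=> [/s1 [k e] lt].
  have [k' hk'] : exists k', forall i, i < m -> 1 < E1 (npair n i) k'.
    elim: m lt {e} => [|m IH] lt; first by exists 0.
    have [j jm|k1 h1] := IH; first by apply: lt; exact: ltnW.
    have [r /s1 [k2 h2]] := lt m (leqnn _).
    exists (maxn k1 k2) => i; rewrite ltnS leq_eqVlt => /orP[/eqP ->|/h1].
      by rewrite (m1 _ _ _ _ (leq_maxr k1 k2) h2).
    case e1: (E1 _ _) => [|[|r']] // _.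
    by rewrite (m1 _ _ _ _ (leq_maxl k1 k2) e1).
  exists (maxn m.+1 (maxn k k')); apply/found; split.
  - by rewrite leq_max ltnSn.
  - by apply: m1 e; rewrite !leq_max leqnn orbT.
  - move=> i /hk'; case e1: (E1 _ _) => [|[|r']] // _.
    by rewrite (m1 _ _ k' _ _ e1) // !leq_max leqnn !orbT.
- move=> n m k k' le /found [mk e lt]; apply/found; split.
  - exact: leq_trans le.
  - exact: m1 e.
  - move=> i /lt; case e1: (E1 _ _) => [|[|r']] // _.
    by rewrite (m1 _ _ _ _ le e1).
Qed.

(** The construction simulates a single program, that of the given machine, so each program may have
    its own bounded evaluator. *)
Lemma approximable c : exists E, approximates E c.
Proof.
elim: c => [||||f [E1 h1] g [E2 h2]|f [E1 h1] g [E2 h2]|f [E1 h1] g [E2 h2]|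
  f [E1 h1]].
- by exists (fun n _ => 1); apply: (@computable_approximates _ (fun=> 0)) => //;
    computability.
- by exists (fun n _ => n.+2); apply: (@computable_approximates _ succn) => //;
    exists csucc.
- by exists (fun n _ => (nfst n).+1); apply: (@computable_approximates _ nfst) => //;
    computability.
- by exists (fun n _ => (nsnd n).+1); apply: (@computable_approximates _ nsnd) => //;
    computability.
- by eexists; apply: approximates_pair h1 h2.
- by eexists; apply: approximates_comp h1 h2.
- by eexists; apply: approximates_prec h1 h2.
- by eexists; apply: approximates_mu h1.
Qed.

(** * Binary strings as numbers and Kraft's inequality *)

(* A number stands for the infinite string of its binary digits, least
   significant first; its prefix of length n is then [w %% 2 ^ n]. *)
Definition bit (w k : nat) : bool := odd (w %/ 2 ^ k).

Lemma modn_exp2S w n : w %% 2 ^ n.+1 = w %% 2 ^ n + bit w n * 2 ^ n.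
Proof.
have e : w = (w %/ 2 ^ n)./2 * 2 ^ n.+1 + (w %% 2 ^ n + bit w n * 2 ^ n).
  rewrite {1}(divn_eq w (2 ^ n)) -{1}(odd_double_half (w %/ 2 ^ n)).
  by rewrite mulnDl expnS mulnA muln2 /bit; lia.
have rn : w %% 2 ^ n < 2 ^ n by rewrite ltn_mod expn_gt0.
rewrite [in LHS]e modnMDl modn_small // expnS.
by move: rn; case: (bit w n) => /=; lia.
Qed.

Lemma bit_mod w k j : bit (w %% 2 ^ k) j = (j < k) && bit w j.
Proof.
rewrite /bit; case: ltnP => [jk|kj] /=; last first.
  rewrite divn_small //; apply: leq_trans (leq_pexp2l _ kj) => //.
  by rewrite ltn_mod expn_gt0.
rewrite {2}(divn_eq w (2 ^ k)) -(subnK (ltnW jk)) expnD mulnA.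
rewrite divnMDl ?expn_gt0 // oddD oddM oddX subn_eq0 leqNgt jk.
by rewrite andbF.
Qed.

(** The arithmetic form of the update of the digits in [next], both for a change and for a
    creation. *)
Lemma bit_set w k j : bit (w %% 2 ^ k + 2 ^ k) j = if j < k then bit w j else j == k.
Proof.
case: (ltngtP j k) => [jk|kj|->].
- have -> : bit w j = bit (w %% 2 ^ k) j by rewrite bit_mod jk.
  rewrite /bit.
  rewrite -{2}(subnK (ltnW jk)) expnD divnDr ?dvdn_mull // mulnK ?expn_gt0 //.
  by rewrite oddD oddX subn_eq0 leqNgt jk addbF.
- rewrite /bit divn_small //.
  apply: (@leq_trans (2 ^ k.+1)); last by rewrite leq_pexp2l.
  by rewrite expnS mul2n -addnn ltn_add2r ltn_mod expn_gt0.
- rewrite /bit divnDr // divnn expn_gt0 /= divn_small // ltn_mod.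
  by rewrite expn_gt0.
Qed.

Lemma eq_modn_bits w w' n :
  (forall j, j < n -> bit w j = bit w' j) -> w %% 2 ^ n = w' %% 2 ^ n.
Proof.
elim: n => [|n IH] h; first by rewrite !modn1.
by rewrite !modn_exp2S (h n) // IH // => j jn; apply: h; exact: ltnW.
Qed.

Lemma bits_modn w w' n j :
  w %% 2 ^ n = w' %% 2 ^ n -> j < n -> bit w j = bit w' j.
Proof.
by move=> e jn; have := bit_mod w n j; rewrite e bit_mod jn.
Qed.

Lemma strcode_rcons s b : strcode (rcons s b) = strcode s + 2 ^ size s * b.+1.
Proof.
elim: s => [|a s /= ->]; first by rewrite mul1n.
by rewrite expnS -mulnA doubleD mul2n; lia.
Qed.

(** Bijective numeration raises each of the [n] digits by 1, which adds [2 ^ n - 1] in total. *)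
Lemma strcode_bits w n : (strcode (mkseq (bit w) n)).+1 = 2 ^ n + w %% 2 ^ n.
Proof.
elim: n => [|n IH]; first by rewrite modn1.
rewrite mkseqS strcode_rcons -addSn IH size_mkseq modn_exp2S expnS.
by case: (bit w n) => /=; lia.
Qed.

Lemma strcode_inj : injective strcode.
Proof.
elim=> [|a s IH] [|b t] //= [e].
have ab : a = b.
  by have := congr1 odd e; rewrite !oddD !odd_double !oddb.
by rewrite ab (IH t) //; apply: double_inj; move: e; rewrite ab => /addIn.
Qed.

Lemma strcode_size s : 2 ^ size s <= (strcode s).+1 < 2 ^ (size s).+1.
Proof.
elim: s => [|a s /= /andP[h1 h2]] //=.
by rewrite !(expnS 2 (size s).+1) {1}expnS; case: a; lia.
Qed.

Lemma strcode_ltn s n : ((strcode s).+1 < 2 ^ n.+1) = (size s <= n).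
Proof.
have /andP[h1 h2] := strcode_size s; apply/idP/idP => h.
  by rewrite -ltnS -(@ltn_exp2l 2) // (leq_ltn_trans h1).
by apply: leq_trans h2 _; rewrite leq_exp2l.
Qed.

(** Induction on [L], splitting [S] by the first bit: the tails in each half are again prefix-free,
    so each half contributes at most half of the bound. *)
Lemma kraft L (S : seq (seq bool)) :
  uniq S -> {in S &, forall p q, prefix p q -> p = q} ->
  {in S, forall p, size p <= L} ->
  \sum_(p <- S) 2 ^ (L - size p) <= 2 ^ L.
Proof.
elim: L S => [|L IH] S uS pS sS; case: (boolP ([::] \in S)) => nS.
(* A prefix-free set containing the empty string contains nothing else. *)
1,3: have -> : S = [:: [::]] by apply/perm_small_eq => //; apply: uniq_perm => // p;
  rewrite inE; apply/idP/eqP => [pin|->] //; apply/esym/pS => //; exact: prefix0s.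
1,2: by rewrite big_seq1 subn0.
  rewrite big1_seq // => p /andP[_ pin].
  by have := sS p pin; rewrite leqn0 size_eq0 => /eqP e; rewrite -e pin in nS.
pose T b := [seq behead p | p <- S & head false p == b].
have hT b : {in [seq p <- S | head false p == b], forall p, p = b :: behead p}.
  move=> p; rewrite mem_filter => /andP[/eqP <-].
  by case: p => // pS'; rewrite pS' in nS.
have iT b q : q \in T b -> b :: q \in S.
  move=> /mapP[p pin ->]; rewrite -(hT _ _ pin).
  by move: pin; rewrite mem_filter => /andP[].
have sT b : \sum_(p <- S | head false p == b) 2 ^ (L.+1 - size p) <= 2 ^ L.
  rewrite -big_filter.
  have -> : \sum_(i <- [seq p <- S | head false p == b]) 2 ^ (L.+1 - size i)
    = \sum_(q <- T b) 2 ^ (L - size q).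
    rewrite big_map big_seq [RHS]big_seq; apply: eq_bigr => p /hT e.
    by rewrite {1}e.
  apply: IH.
  - rewrite map_inj_in_uniq ?filter_uniq // => p q /hT ep /hT eq e.
    by rewrite ep eq e.
  - move=> p q /iT pin /iT qin pq.
    by have := pS _ _ pin qin; rewrite prefix_cons eqxx => /(_ pq) [].
  - by move=> p /iT /sS.
rewrite (bigID (fun p => head false p == true)) /= expnS mul2n -addnn leq_add //.
under eq_bigl => p do rewrite eqb_id -eqbF_neg.
exact: sT.
Qed.

(** For each length [n], the [2 ^ (n - m)] extensions of [v] would have descriptions of total weight
    at least [2 ^- m]. There are more than [2 ^ m] lengths, so the total weight would exceed 1,
    against Kraft's inequality. *)
Lemma incompressible_extension (U : seq bool -> option (seq bool)) m L v :
  (forall p q, U p <> None -> U q <> None -> prefix p q -> p = q) ->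
  v < 2 ^ m -> 2 ^ m < L - m ->
  ~ (forall n u, m < n <= L -> u < 2 ^ n -> u %% 2 ^ m = v ->
      exists2 p, size p <= n & U p = Some (mkseq (bit u) n)).
Proof.
move=> hU vm mL H.
have /choice [P hP] : forall i : nat * nat, exists p,
    m < i.1 <= L -> i.2 < 2 ^ i.1 -> i.2 %% 2 ^ m = v ->
    size p <= i.1 /\ U p = Some (mkseq (bit i.2) i.1).
  move=> [n u] /=; case: (pselect [/\ m < n <= L, u < 2 ^ n & u %% 2 ^ m = v]).
    by move=> [h1 h2 h3]; have [p p1 p2] := H n u h1 h2 h3; exists p.
  by move=> nh; exists [::] => h1 h2 h3; exfalso; exact: nh.
(* An extension of [v] to length [n] is given by its [n - m] further digits, the number [j]. *)
pose I := [seq (n, v + 2 ^ m * j) |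
  n <- iota m.+1 (L - m), j <- iota 0 (2 ^ (n - m))].
have uI : uniq I.
  apply: allpairs_uniq_dep => [|n _|]; rewrite ?iota_uniq //.
  move=> [n1 j1] [n2 j2] _ _ /= [-> /addnI /eqP].
  by rewrite eqn_pmul2l ?expn_gt0 // => /eqP ->.
have hI i : i \in I -> [/\ m < i.1 <= L, i.2 < 2 ^ i.1 & i.2 %% 2 ^ m = v].
  move=> /allpairsPdep[n [j [+ + ->]]] /=; rewrite !mem_iota add0n.
  move=> /andP[h1 h2] /= h3; have mn : m <= n by exact: ltnW.
  split; first by rewrite h1 /=; lia.
    rewrite -(subnKC mn) expnD; apply: (@leq_trans (2 ^ m * j.+1)).
      by rewrite mulnS ltn_add2r.
    by rewrite leq_mul2l h3 orbT.
  by rewrite addnC mulnC modnMDl modn_small.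
have injP : {in I &, injective P}.
  move=> i j /hI [i1 i2 i3] /hI [j1 j2 j3] e.
  have [_ ei] := hP i i1 i2 i3; have [_ ej] := hP j j1 j2 j3.
  move: ei; rewrite e ej => -[em].
  have es : i.1 = j.1 by have := congr1 size em; rewrite !size_mkseq.
  case: i j es i2 j2 em {i1 i3 j1 j3 e ej} => n u [n' u'] /= <- un un' em.
  have := congr1 (fun s => (strcode s).+1) em; rewrite /= !strcode_bits.
  by rewrite !modn_small // => /addnI ->.
have := @kraft L [seq P i | i <- I].
rewrite map_inj_in_uniq // => /(_ uI).
have /[swap]/[apply] : {in [seq P i | i <- I] &, forall p q, prefix p q -> p = q}.
  move=> p q /mapP[i /hI [i1 i2 i3] ->] /mapP[j /hI [j1 j2 j3] ->].
  by apply: hU; [have [_ ->] := hP i i1 i2 i3 | have [_ ->] := hP j j1 j2 j3].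
have /[swap]/[apply] : {in [seq P i | i <- I], forall p, size p <= L}.
  move=> p /mapP[i /hI [i1 i2 i3] ->]; have [h _] := hP i i1 i2 i3.
  by case/andP: i1 => _; exact: leq_trans.
(* Replacing each description length by the bound [n] can only lower the sum, and what remains is
   [(L - m) * 2 ^ (L - m)]. *)
apply/negP; rewrite -ltnNge big_map.
apply: (@leq_trans (\sum_(i <- I) 2 ^ (L - i.1))); last first.
  rewrite big_seq [X in _ <= X]big_seq; apply: leq_sum => i /hI [i1 i2 i3].
  have [h _] := hP i i1 i2 i3; rewrite leq_pexp2l //; exact: leq_sub2l.
rewrite big_allpairs_dep /=.
have -> : \sum_(i <- iota m.+1 (L - m)) \sum_(j <- iota 0 (2 ^ (i - m))) 2 ^ (L - i)
    = \sum_(i <- iota m.+1 (L - m)) 2 ^ (L - m).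
  rewrite big_seq [RHS]big_seq; apply: eq_bigr => n; rewrite mem_iota => h.
  rewrite big_const_seq count_predT size_iota iter_addn_0 -expnD.
  by congr (2 ^ _); lia.
rewrite big_const_seq count_predT size_iota iter_addn_0.
rewrite mulnC; apply: (@leq_trans ((2 ^ m).+1 * 2 ^ (L - m))); last first.
  by rewrite leq_mul2r mL orbT.
have mL' : m <= L by lia.
by rewrite mulSn -expnD subnKC // -addn1 addnC leq_add2r expn_gt0.
Qed.

(** * The construction *)

Lemma strcode_surj n : exists s, strcode s = n.
Proof.
elim/ltn_ind: n => [[|n]] IH; first by exists [::].
have [|s hs] := IH n./2; first by lia.
by exists (odd n :: s); rewrite /= hs addnC odd_double_half.
Qed.

Lemma first_difference (f g : nat -> bool) n :
  (forall j, j < n -> f j = g j) \/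
  exists2 j, j < n & f j != g j /\ forall i, i < j -> f i = g i.
Proof.
elim: n => [|n [IH|[j jn h]]]; first by left.
  case: (eqVneq (f n) (g n)) => e; last by right; exists n.
  by left => j; rewrite ltnS leq_eqVlt => /orP[/eqP ->|/IH].
by right; exists j => //; exact: ltnW.
Qed.

Definition bend (s : nat) : nat := 2 ^ s.+2.

Lemma bend_gt s : s < bend s.
Proof. by rewrite (leq_trans (ltn_expl s (ltnSn 1))) // leq_exp2l // !leqW. Qed.

Lemma leq_bend s s' : s <= s' -> bend s <= bend s'.
Proof. by move=> h; rewrite leq_exp2l. Qed.

Section Construction.
Variable E : nat -> nat -> nat.

(* The programs of length at most n are coded by the numbers below 2^(n+1) - 1,
   and 2^n + u is one more than the code of the string of length n with value u,
   hence the answer of [E] for that string. *)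
Definition comp (t n u : nat) : bool :=
  has (fun p => E p t == 2 ^ n + u) (iota 0 (2 ^ n.+1).-1).

(** Lengths start at [s.+2] because digit [s] is the fixed 1 at the start of the block: the block
    varies only the digits after it. *)
Definition injured (t w s : nat) : bool :=
  all (fun n => (s.+1 < n) ==> comp t n (w %% 2 ^ n)) (iota 0 (bend s).+1).

(* The digits of [M] mark the starts of the active blocks.  A position k is a
   candidate when replacing digit k by 1 and clearing the later digits gives the
   lexicographic successor of the content of an injured block. *)
Definition cand (t w M k : nat) : bool :=
  has (fun s => [&& bit M s, k < bend s, injured t w s, ~~ bit w k
    & all (fun j => (k < j) ==> bit w j) (iota 0 (bend s))]) (iota 0 k).

(** [z] pairs the digits of the approximation with the starts of the active blocks. In a change,
    truncating [M] at [k] keeps the moving block, which starts below [k], and cancels the later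
    ones. *)
Definition next (t z : nat) : nat :=
  let w := nfst z in let M := nsnd z in
  let k := find (cand t w M) (iota 0 (bend t)) in
  if k < bend t then npair (w %% 2 ^ k + 2 ^ k) (M %% 2 ^ k)
  else if all (fun s => bit M s ==> (bend s <= t)) (iota 0 t.+1) then
    npair (w %% 2 ^ t + 2 ^ t) (M %% 2 ^ t + 2 ^ t)
  else z.

(** Stages count from 1, so no block starts at position 0 and digit 0 remains 0; this keeps the
    limit below 1. *)
Definition run : nat -> nat := prec 0 (fun i z => next i.+1 z).
Definition word t := nfst (run t).
Definition starts t := nsnd (run t).

(** The position changed between stages [t] and [t.+1]; the value [bend t.+1] means that there is no
    candidate. *)
Definition chg t :=
  find (cand t.+1 (word t) (starts t)) (iota 0 (bend t.+1)).
Definition changed t := chg t < bend t.+1.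

Lemma candP t w M k : reflect
  (exists s, [/\ bit M s, s < k < bend s, injured t w s, ~~ bit w k
    & forall j, k < j < bend s -> bit w j]) (cand t w M k).
Proof.
apply: (iffP hasP).
  move=> [s]; rewrite mem_iota => /andP[_ sk] /and5P[h1 h2 h3 h4 /allP h5].
  exists s; split=> //; first by rewrite sk.
  by move=> j /andP[kj js]; have := h5 j; rewrite mem_iota js kj => /(_ isT).
move=> [s [h1 /andP[h2 h2'] h3 h4 h5]]; exists s; first by rewrite mem_iota.
rewrite h1 h2' h3 h4 /=; apply/allP => j; rewrite mem_iota => /andP[_ js].
by apply/implyP => kj; apply: h5; rewrite kj.
Qed.

Lemma injuredP t w s : reflect
  (forall n, s.+1 < n <= bend s -> comp t n (w %% 2 ^ n)) (injured t w s).
Proof.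
apply: (iffP allP) => h n.
  move=> /andP[sn nb]; have := h n.
  by rewrite mem_iota sn /= add0n ltnS nb => /(_ isT).
by rewrite mem_iota add0n ltnS => nb; apply/implyP => sn; apply: h; rewrite sn.
Qed.

Lemma injured_ext t w y s :
  (forall j, j < bend s -> bit y j = bit w j) -> injured t w s -> injured t y s.
Proof.
move=> e /injuredP h; apply/injuredP => n hn; have := h n hn.
rewrite (@eq_modn_bits y w n) // => j jn; apply: e; apply: leq_trans jn _.
by case/andP: hn.
Qed.

Lemma least_cand t k : cand t.+1 (word t) (starts t) k -> k < bend t.+1 ->
  changed t && (chg t <= k).
Proof.
move=> ck kb; have le : chg t <= k.
  rewrite leqNgt; apply/negP => h; have := before_find 0 h.
  by rewrite nth_iota ?add0n ?ck.
by rewrite le andbT /changed (leq_ltn_trans le).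
Qed.

Lemma chgP t : changed t -> exists s, [/\ bit (starts t) s, s < chg t < bend s,
  injured t.+1 (word t) s, ~~ bit (word t) (chg t)
  & forall j, chg t < j < bend s -> bit (word t) j].
Proof.
move=> h; have hP : has (cand t.+1 (word t) (starts t)) (iota 0 (bend t.+1)).
  by rewrite has_find size_iota.
by have := nth_find 0 hP; rewrite nth_iota // add0n => /candP.
Qed.

(** * The effect of one stage *)

Definition created t := ~~ changed t /\
  forall s, s <= t.+1 -> bit (starts t) s -> bend s <= t.+1.

Lemma word_changed t j : changed t ->
  bit (word t.+1) j = if j < chg t then bit (word t) j else j == chg t.
Proof.
move=> h; rewrite /word {1}/run precS -/run /next -/(chg t) -/(changed t) h.
by rewrite nfst_pair bit_set.
Qed.

Lemma starts_changed t j : changed t ->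
  bit (starts t.+1) j = (j < chg t) && bit (starts t) j.
Proof.
move=> h; rewrite /starts {1}/run precS -/run /next -/(chg t) -/(changed t) h.
by rewrite nsnd_pair bit_mod.
Qed.

Lemma next_created t : created t -> run t.+1 =
  npair (word t %% 2 ^ t.+1 + 2 ^ t.+1) (starts t %% 2 ^ t.+1 + 2 ^ t.+1).
Proof.
move=> [nc h]; rewrite /word {1}/run precS -/run /next -/(chg t) -/(changed t).
rewrite (negbTE nc) ifT //; apply/allP => s; rewrite mem_iota => /andP[_ hs].
by apply/implyP; apply: h.
Qed.

Lemma word_created t j : created t ->
  bit (word t.+1) j = if j < t.+1 then bit (word t) j else j == t.+1.
Proof. by move=> h; rewrite /word next_created // nfst_pair bit_set. Qed.

Lemma starts_created t j : created t ->
  bit (starts t.+1) j = if j < t.+1 then bit (starts t) j else j == t.+1.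
Proof. by move=> h; rewrite /starts next_created // nsnd_pair bit_set. Qed.

Lemma run_idle t : ~~ changed t -> ~ created t -> run t.+1 = run t.
Proof.
move=> nc ncr; rewrite {1}/run precS -/run /next -/(chg t) -/(changed t).
rewrite (negbTE nc); case: ifP => // /allP h; case: ncr; split=> // s st bs.
by have := h s; rewrite mem_iota add0n ltnS st bs => /(_ isT).
Qed.

Variant step_spec t : Prop :=
| StepChanged of changed t
| StepCreated of created t
| StepIdle of ~~ changed t & word t.+1 = word t & starts t.+1 = starts t.

Lemma stepP t : step_spec t.
Proof.
case: (boolP (changed t)) => nc; first exact: StepChanged.
case: (pselect (created t)) => cr; first exact: StepCreated.
by apply: StepIdle => //; rewrite /word /starts run_idle.
Qed.

Hypothesis E_mono : forall p m t t', t <= t' -> E p t = m.+1 -> E p t' = m.+1.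

Lemma comp_mono t t' n u : t <= t' -> comp t n u -> comp t' n u.
Proof.
move=> le /hasP[p pin /eqP e]; apply/hasP; exists p => //; apply/eqP.
move: e; have : 0 < 2 ^ n + u by rewrite addn_gt0 expn_gt0.
by case: (2 ^ n + u) => // m _; exact: E_mono.
Qed.

Lemma injured_mono t t' w s : t <= t' -> injured t w s -> injured t' w s.
Proof.
by move=> le /injuredP h; apply/injuredP => n /h; exact: comp_mono.
Qed.

(** * Invariants of the active blocks *)

Lemma starts_range t s : bit (starts t) s -> 0 < s <= t.
Proof.
elim: t => [|t IH]; first by rewrite /starts /run /= /bit div0n.
case: (stepP t) => [ch|cr|_ _ ->].
- by rewrite starts_changed // => /andP[_ /IH /andP[-> /leqW]].
- rewrite starts_created //; case: ifP => _; first by move=> /IH /andP[-> /leqW].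
  by move=> /eqP ->; rewrite leqnn.
- by move=> /IH /andP[-> /leqW].
Qed.

(** A block is created only at a stage by which all active blocks have ended, and its start equals
    that stage. *)
Lemma starts_disjoint t s s' :
  bit (starts t) s -> bit (starts t) s' -> s < s' -> bend s <= s'.
Proof.
elim: t s s' => [|t IH] s s'; first by rewrite /starts /run /= /bit div0n.
case: (stepP t) => [ch|cr|_ _ ->]; last exact: IH.
  by rewrite !starts_changed // => /andP[_ h] /andP[_ h']; exact: IH.
rewrite !starts_created //; case: ltnP => [st bs|st /eqP ->].
  case: ltnP => [s't bs'|s't /eqP ->]; first exact: IH.
  by move=> _; apply: cr.2 => //; exact: ltnW.
by case: ltnP => [h _ h'|h /eqP -> h']; lia.
Qed.

Lemma starts_unique t s s' k : bit (starts t) s -> bit (starts t) s' ->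
  s <= k < bend s -> s' <= k < bend s' -> s = s'.
Proof.
move=> bs bs' /andP[h1 h2] /andP[h3 h4].
case: (ltngtP s s') => // lt.
  by have := starts_disjoint bs bs' lt; lia.
by have := starts_disjoint bs' bs lt; lia.
Qed.

(** A change clears the digits after its position together with the blocks starting there, so no
    digit 1 outlives its block. *)
Lemma word_in_block t j : bit (word t) j ->
  exists2 s, bit (starts t) s & s <= j < bend s.
Proof.
elim: t => [|t IH]; first by rewrite /word /run /= /bit div0n.
case: (stepP t) => [ch|cr|_ -> ->]; last exact: IH.
  rewrite word_changed //; case: ltnP => [jk /IH [s bs hs]|_ /eqP ->].
    exists s => //; rewrite starts_changed // bs andbT.
    by apply: leq_ltn_trans jk; case/andP: hs.
  have [s [bs /andP[h1 h2] _ _ _]] := chgP ch; exists s; last by rewrite ltnW.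
  by rewrite starts_changed // h1.
rewrite word_created //; case: ltnP => [jk /IH [s bs hs]|_ /eqP ->].
  exists s => //; rewrite starts_created //.
  by rewrite ifT //; apply: leq_ltn_trans jk; case/andP: hs.
by exists t.+1; rewrite ?leqnn ?bend_gt // starts_created // ltnn eqxx.
Qed.

Lemma word_start t s : bit (starts t) s -> bit (word t) s.
Proof.
elim: t => [|t IH]; first by rewrite /starts /run /= /bit div0n.
case: (stepP t) => [ch|cr|_ -> ->]; last exact: IH.
  by rewrite starts_changed // => /andP[h /IH bs]; rewrite word_changed // h.
by rewrite starts_created // word_created //; case: ltnP.
Qed.

Lemma word_supp t j : bend t <= j -> bit (word t) j = false.
Proof.
move=> h; apply/negP => /word_in_block [s /starts_range /andP[_ /leq_bend le]].
by move=> /andP[_]; apply/negP; rewrite -leqNgt (leq_trans le).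
Qed.

(** At a creation all active blocks have ended and digits 1 occur in active blocks only; hence
    setting digit [t.+1] is an increase. *)
Lemma created_supp t j : created t -> t < j -> bit (word t) j = false.
Proof.
move=> cr h; apply/negP => /word_in_block [s bs /andP[_]]; apply/negP.
rewrite -leqNgt; apply: leq_trans h; apply: cr.2 => //.
by case/andP: (starts_range bs) => _ /leqW.
Qed.

(* The strings that precede the current content of a block lexicographically
   have been skipped because all of their prefixes in the block are compressible. *)
Definition skipped t w M := forall s j y, bit M s -> s < j < bend s -> bit w j ->
  (forall i, i < j -> bit y i = bit w i) -> ~~ bit y j -> injured t y s.

(** Since [w] has only ones from [i] to the end of the block, [y] either equals [w] there or
    precedes it at the first difference, and then it was skipped. *)
Lemma skipped_agree t t' w M s i y : skipped t w M -> t <= t' -> bit M s ->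
  injured t' w s -> s < i ->
  (forall j, i <= j < bend s -> bit w j) -> (forall j, j < i -> bit y j = bit w j) ->
  injured t' y s.
Proof.
move=> sk le bs inj si ones e.
have [h|[j jb [ne agr]]] := first_difference (bit y) (bit w) (bend s).
  exact: injured_ext inj.
have ij : i <= j by rewrite leqNgt; apply/negP => /e /eqP; rewrite (negbTE ne).
have wj : bit w j by apply: ones; rewrite ij.
apply: injured_mono le _; apply: (sk s j) => //; first by rewrite jb (leq_trans si).
by move: ne; rewrite wj; case: (bit y j).
Qed.

Lemma skipped_run t : skipped t (word t) (starts t).
Proof.
elim: t => [|t IH]; first by move=> s j y; rewrite /starts /run /= /bit div0n.
case: (stepP t) => [ch|cr|_ -> ->]; last first.
- by move=> s j y h1 h2 h3 h4 h5; apply: injured_mono (leqnSn t) _; exact: IH h5.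
- move=> s j y; rewrite starts_created //; case: ltnP => [st bs hs|_ /eqP -> hs].
    have le := cr.2 s (ltnW st) bs; have jt : j < t.+1.
      by case/andP: hs => _ h; exact: leq_trans le.
    rewrite word_created // jt => bj agr nbj; apply: injured_mono (leqnSn t) _.
    apply: IH nbj => // i ij; rewrite agr // word_created //.
    by rewrite (ltn_trans ij jt).
  (* A new block has no digit 1 after its start, so no string precedes its content. *)
  case/andP: hs => h1 h2; rewrite word_created // ltnNge (ltnW h1) /=.
  by rewrite gtn_eqF.
- move=> s j y; rewrite starts_changed // => /andP[sk bs] hs.
  rewrite word_changed //; case: ltnP => [jk bj agr nbj|_ /eqP ej].
    apply: injured_mono (leqnSn t) _; apply: IH nbj => // i ij.
    by rewrite agr // word_changed // (ltn_trans ij jk).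
  (* Here [y] agrees with the old content up to and including [chg t], after which that content
     consists of ones up to the end of the block. *)
  rewrite ej => agr nbj; have [s0 [bs0 hs0 inj nb ones]] := chgP ch.
  have es : s = s0.
    apply: (starts_unique bs bs0 (k := chg t)).
      by rewrite -ej; case/andP: hs => /ltnW -> ->.
    by case/andP: hs0 => /ltnW -> ->.
  subst s0; apply: (skipped_agree IH (leqnSn t) bs inj (i := (chg t).+1)) => //.
    exact: leqW.
  move=> i; rewrite ltnS leq_eqVlt => /orP[/eqP ->|ik].
    by rewrite (negbTE nbj) (negbTE nb).
  by rewrite agr // word_changed // ik.
Qed.

Variable U : seq bool -> option (seq bool).
Hypothesis U_prefix : forall p q, U p <> None -> U q <> None -> prefix p q -> p = q.
Hypothesis compP : forall n u, u < 2 ^ n -> (exists t, comp t n u) <->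
  exists2 p, size p <= n & U p = Some (mkseq (bit u) n).

(** If only ones were left, all extensions of the first [s.+1] digits would be compressible
    throughout the block, against [incompressible_extension]. So an injured block always has a
    successor to move to. *)
Lemma injured_not_full t s : bit (starts t) s -> injured t.+1 (word t) s ->
  exists2 j, s < j < bend s & ~~ bit (word t) j.
Proof.
move=> bs inj; apply: contrapT => full.
have ones j : s < j < bend s -> bit (word t) j.
  by move=> h; case: (boolP (bit (word t) j)) => // nb; case: full; exists j.
apply: (@incompressible_extension U s.+1 (bend s) (word t %% 2 ^ s.+1) U_prefix).
- by rewrite ltn_mod expn_gt0.
(* The choice of [bend]: [2 ^ s.+2 - s.+1] exceeds [2 ^ s.+1]. *)
- have := ltn_expl s.+1 (ltnSn 1); rewrite /bend (expnS 2 s.+1); lia.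
move=> n u hn un e; apply/(compP un); exists t.+1.
rewrite -{1}(modn_small un); apply: (injuredP t.+1 u s) => //.
apply: (skipped_agree (@skipped_run t) (leqnSn t) bs inj (ltnSn s)) => //.
by move=> j; exact: bits_modn.
Qed.

(** The last digit 0 of an injured block is a candidate, so the least candidate is no later. *)
Lemma injured_changed t s : bit (starts t) s -> injured t.+1 (word t) s ->
  changed t && (chg t < bend s).
Proof.
move=> bs inj; have [j0 hj0 nj0] := injured_not_full bs inj.
pose Q j := (s < j < bend s) && ~~ bit (word t) j.
have exQ : exists j, Q j by exists j0; rewrite /Q hj0.
have ubQ j : Q j -> j <= bend s by move=> /andP[/andP[_ /ltnW]].
case: (ex_maxnP exQ ubQ) => k /andP[hk nk] mk.
have ck : cand t.+1 (word t) (starts t) k.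
  apply/candP; exists s; split=> // j /andP[kj jb].
  apply: contraT => nb; suff : j <= k by lia.
  by apply: mk; rewrite /Q nb jb (ltn_trans _ kj) //; case/andP: hk.
case/andP: hk => sk kb; have st : s <= t by case/andP: (starts_range bs).
have /andP[-> le] : changed t && (chg t <= k).
  by apply: least_cand ck _; apply: leq_trans kb _; exact/leq_bend/leqW.
by rewrite (leq_ltn_trans le).
Qed.

(** * Stabilisation, true stages and permanent blocks *)

Definition stable m T := forall t, T <= t -> changed t -> m <= chg t.

Lemma word_up t m : (changed t -> m < chg t) -> bit (word t) m ->
  bit (word t.+1) m.
Proof.
move=> h bm; case: (stepP t) => [ch|cr|_ -> _] //.
  by rewrite word_changed // h.
rewrite word_created //; case: ltnP => // tm.
by rewrite (created_supp cr tm) in bm.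
Qed.

(* Once the positions below m are settled, the digit at m can only change from
   0 to 1. *)
Lemma stable_exists m : exists T, stable m T.
Proof.
elim: m => [|m [T IH]]; first by exists 0.
case: (pselect (exists2 t, T <= t & changed t /\ chg t = m)) => [[t Tt [ch em]]|nex].
  have up t' : t < t' -> bit (word t') m.
    elim: t' => // t' IHt; rewrite ltnS leq_eqVlt => /orP[/eqP <-|tt'].
      by rewrite word_changed // em ltnn eqxx.
    apply: word_up; last exact: IHt.
    move=> ch'; have := IH t' (leq_trans Tt (ltnW tt')) ch'.
    rewrite leq_eqVlt => /orP[/eqP e|//].
    by have [s [_ _ _ nb _]] := chgP ch'; rewrite -e IHt in nb.
  exists t.+1 => t' tt' ch'; have := IH t' (leq_trans Tt (ltnW tt')) ch'.
  rewrite leq_eqVlt => /orP[/eqP e|//].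
  by have [s [_ _ _ nb _]] := chgP ch'; rewrite -e up in nb.
exists T => t Tt ch; have := IH t Tt ch.
by rewrite leq_eqVlt => /orP[/eqP e|//]; case: nex; exists t.
Qed.

(** [stable] constrains changes only; creations after stage [T] happen beyond position [T], whence
    the condition [m <= T.+1]. *)
Lemma stable_const m T t j : stable m T -> T <= t -> m <= T.+1 -> j < m ->
  bit (word t) j = bit (word T) j /\ bit (starts t) j = bit (starts T) j.
Proof.
move=> st + mT jm; elim: t => [|t IH]; first by rewrite leqn0 => /eqP ->.
rewrite leq_eqVlt => /orP[/eqP -> //|]; rewrite ltnS => Tt; have [<- <-] := IH Tt.
case: (stepP t) => [ch|cr|_ -> ->] //.
  have lt : j < chg t by apply: leq_trans jm _; exact: st.
  by rewrite word_changed // starts_changed // lt.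
have lt : j < t.+1 by lia.
by rewrite word_created // starts_created // lt.
Qed.

(* Among the changes after stage N take one in a block with the least start, and
   the last such: the blocks that change afterwards are created afterwards, and
   the start of a block is the stage of its creation. *)
Lemma true_stage N : exists2 T, N <= T & stable T.+2 T.
Proof.
pose Q s := `[< exists t, [/\ N <= t, changed t, bit (starts t) s
  & s < chg t < bend s] >].
case: (pselect (exists s, Q s)) => [exQ|nQ]; last first.
  exists N => // t Nt ch; exfalso; apply: nQ.
  have [s [h1 h2 _ _ _]] := chgP ch; exists s; apply/asboolP; exists t.
  by split.
case: (ex_minnP exQ) => s /asboolP [t0 [Nt0 ch0 bs0 hs0]] smin.
have [T0 hT0] := stable_exists (bend s).
pose P t := [&& N <= t, changed t, bit (starts t) s & s < chg t < bend s].
have exP : exists t, P t by exists t0; apply/and4P.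
have ubP t : P t -> t <= T0.
  move=> /and4P[_ ch _ /andP[_ lt]]; rewrite leqNgt; apply/negP => /ltnW /hT0.
  by move=> /(_ ch); rewrite leqNgt lt.
case: (ex_maxnP exP ubP) => t /and4P[Nt ch bs hs] tmax.
exists t.+1; first exact: leqW.
(* The change at stage [t] lies in the block of [s] and cancels all later blocks, so any active
   start beyond [s] was created afterwards. *)
have late t' s' : t < t' -> bit (starts t') s' -> s < s' -> t.+1 < s'.
  elim: t' s' => // t' IH s'; rewrite ltnS leq_eqVlt => /orP[/eqP <-|tt'].
    rewrite starts_changed // => /andP[sk bs'] ss'.
    have := starts_disjoint bs bs' ss'; case/andP: hs; lia.
  case: (stepP t') => [ch'|cr'|_ _ ->]; last exact: IH.
    by rewrite starts_changed // => /andP[_]; exact: IH.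
  rewrite starts_created //; case: ifP => _; first exact: IH.
  by move=> /eqP -> _; rewrite ltnS.
move=> t' tt' ch'; have [s' [bs' hs' _ _ _]] := chgP ch'.
have Nt' : N <= t' by apply: leq_trans Nt _; exact: ltnW.
have ss' : s <= s' by apply: smin; apply/asboolP; exists t'.
have lt : s < s'.
  rewrite ltn_neqAle ss' andbT; apply/eqP => e; subst s'.
  suff : t' <= t by lia.
  by apply: tmax; apply/and4P.
have := late t' s' tt' bs' lt; case/andP: hs'; lia.
Qed.

(** At a true stage, an active block starting at [N] or later is never cancelled. If there is none,
    all active blocks have ended, so a block is created at the next stage. *)
Lemma permanent_start N : exists s T, N <= s /\ forall t, T <= t -> bit (starts t) s.
Proof.
have [T NT st] := true_stage (maxn N (bend N)).
have st1 : stable T.+1 T by move=> t h1 h2; apply: ltnW; exact: st.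
case: (pselect (exists2 s, N <= s & bit (starts T) s)) => [[s Ns bs]|nex].
  exists s, T; split=> // t Tt.
  have sT : s < T.+1 by rewrite ltnS; case/andP: (starts_range bs).
  by rewrite (stable_const st1 Tt (leqnn _) sT).2.
have small s : bit (starts T) s -> bend s <= T.
  move=> bs; have sN : s < N by rewrite ltnNge; apply/negP => h; case: nex; exists s.
  apply: leq_trans (leq_bend (ltnW sN)) _; apply: leq_trans NT; exact: leq_maxr.
have nc : ~~ changed T.
  apply/negP => ch; have := st T (leqnn _) ch.
  have [s [/small bs hs _ _ _]] := chgP ch.
  by case/andP: hs; lia.
have cr : created T by split=> // s _ /small h; exact: leqW.
(* Changes from stage [T] on are at positions [T.+2] or later, so the block created at [T.+1]
   survives. *)
exists T.+1, T.+1; split.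
  by apply: leqW; apply: leq_trans NT; exact: leq_maxl.
move=> t Tt; have st2 : stable T.+2 T.+1 by move=> t' h; apply: st; exact: ltnW.
by rewrite (stable_const st2 Tt (leqnn _) (ltnSn _)).2 starts_created // ltnn eqxx.
Qed.

Lemma word_lim : exists b : nat -> bool,
  forall m, exists T, forall t, T <= t -> forall j, j < m -> bit (word t) j = b j.
Proof.
have stab m : exists T, forall t, T <= t -> forall j, j < m ->
    bit (word t) j = bit (word T) j.
  have [T hT] := stable_exists m; exists (maxn T m) => t le j jm.
  have h : stable m (maxn T m).
    by move=> t'; rewrite geq_max => /andP[h _]; exact: hT.
  by rewrite (stable_const h le _ jm).1 // leqW // leq_maxr.
have /choice [tau htau] := stab.
exists (fun j => bit (word (tau j.+1)) j) => m.
have [T hT] := stab m; exists T => t Tt j jm.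
have h1 := htau j.+1 (maxn (tau j.+1) T) (leq_maxl _ _) j (ltnSn j).
by rewrite -h1 (hT _ Tt _ jm) (hT _ (leq_maxr _ _) _ jm).
Qed.

(** * The limit sequence *)

Variable b : nat -> bool.
Hypothesis b_lim :
  forall m, exists T, forall t, T <= t -> forall j, j < m -> bit (word t) j = b j.

Lemma lim_head : b 0 = false.
Proof.
have [T /(_ T (leqnn T) 0 isT) <-] := b_lim 1.
by apply/negP => /word_in_block [s /starts_range]; case: s.
Qed.

Lemma lim_ones N : exists2 k, N <= k & b k.
Proof.
have [s [T [Ns hs]]] := permanent_start N; exists s => //.
have [T' hT'] := b_lim s.+1.
rewrite -(hT' (maxn T T') (leq_maxr _ _) s (ltnSn s)).
by apply/word_start/hs; exact: leq_maxl.
Qed.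

Lemma lim_true_stage N :
  exists2 T, N <= T & forall j, j <= T -> bit (word T) j = b j.
Proof.
have [T NT st] := true_stage N; exists T => // j jT.
have st1 : stable T.+1 T by move=> t h1 h2; apply: ltnW; exact: st.
have [T' hT'] := b_lim j.+1.
rewrite -(hT' (maxn T T') (leq_maxr _ _) j (ltnSn j)).
by rewrite (stable_const st1 (leq_maxl T T') (leqnn _) _).1.
Qed.

(** Take a permanent block. If the limit were compressible at all lengths past its start, the
    finitely many lengths inside the block would be witnessed by some stage, and the block would
    change after it has settled. *)
Lemma lim_incompressible N : exists2 n, N <= n &
  forall p, size p <= n -> U p <> Some (mkseq b n).
Proof.
have [s [T [Ns hs]]] := permanent_start N.
apply: contrapT => nex.
have desc n : s.+1 < n -> exists2 p, size p <= n & U p = Some (mkseq b n).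
  move=> sn; apply: contrapT => nd; apply: nex; exists n; first by lia.
  by move=> p pn Up; apply: nd; exists p.
have [T1 hT1] := b_lim (bend s); have [T2 hT2] := stable_exists (bend s).
pose w := word T1.
have cw n : s.+1 < n <= bend s -> exists t, comp t n (w %% 2 ^ n).
  move=> /andP[sn nb]; apply/compP; first by rewrite ltn_mod expn_gt0.
  have [p pn Up] := desc n sn; exists p => //; rewrite Up; congr Some.
  apply/eq_in_map => j; rewrite mem_iota => /andP[_ jn].
  by rewrite bit_mod jn /w (hT1 _ (leqnn _)) // (leq_trans jn).
have [T3 hT3] : exists T3,
    forall n, n < (bend s).+1 -> s.+1 < n -> comp T3 n (w %% 2 ^ n).
  have gen l : l <= (bend s).+1 -> exists T3,
      forall n, n < l -> s.+1 < n -> comp T3 n (w %% 2 ^ n).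
    elim: l=> [_|l IH lb]; first by exists 0.
    have [T4 hT4] := IH (ltnW lb).
    case: (ltnP s.+1 l) => [sl|ls].
      have [|t ht] := cw l; first by rewrite sl.
      exists (maxn T4 t) => n; rewrite ltnS leq_eqVlt => /orP[/eqP -> _|nl sn].
        exact: comp_mono (leq_maxr _ _) ht.
      by apply: comp_mono (leq_maxl _ _) _; exact: hT4.
    by exists T4 => n; rewrite ltnS leq_eqVlt => /orP[/eqP ->|/hT4 //]; lia.
  exact: gen (leqnn _).
(* By stage [t] the block is permanent, its content final, changes below its end are over, and all
   compressions have been found. *)
pose t := maxn (maxn T T1) (maxn T2 T3).
have inj : injured t.+1 (word t) s.
  apply: (@injured_ext _ w) => [j jb|].
    by rewrite /w !hT1 // /t !leq_max leqnn ?orbT.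
  apply/injuredP => n /andP[sn nb]; apply: (@comp_mono T3); last exact: hT3.
  by rewrite leqW // /t !leq_max leqnn !orbT.
have bs : bit (starts t) s by apply: hs; rewrite /t !leq_max leqnn.
have /andP[ch lt] := injured_changed bs inj.
have : bend s <= chg t by apply: hT2 => //; rewrite /t !leq_max leqnn !orbT.
by rewrite leqNgt lt.
Qed.

(** The increase is lexicographic with digit 0 most significant; the number [word t] itself, read
    with digit 0 least significant, may decrease. *)
Lemma word_increases t : word t.+1 = word t \/ exists k,
  [/\ forall j, j < k -> bit (word t.+1) j = bit (word t) j,
      ~~ bit (word t) k & bit (word t.+1) k].
Proof.
case: (stepP t) => [ch|cr|_ -> _]; [right|right|by left].
  exists (chg t); split; last by rewrite word_changed // ltnn eqxx.
    by move=> j jk; rewrite word_changed // jk.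
  by have [s [_ _ _ nb _]] := chgP ch.
exists t.+1; split; last by rewrite word_created // ltnn eqxx.
  by move=> j jk; rewrite word_created // jk.
by rewrite created_supp.
Qed.

End Construction.

(** * Computability of the construction *)

Lemma computable_bit f g :
  computable f -> computable g -> computable (fun n => bit (f n) (g n) : nat).
Proof.
move=> hf hg; apply: (computable_ext (f := fun n => (f n %/ 2 ^ g n) %% 2)).
  by move=> n; rewrite modn2.
by apply: computable_mod; [apply: computable_div|]; computability.
Qed.

Lemma computable_word E :
  computable (fun z => E (nfst z) (nsnd z)) -> computable (word E).
Proof.
move=> hE.
have hbend f : computable f -> computable (fun n => bend (f n)).
  by move=> hf; rewrite /bend; computability.
have hcomp f g h : computable f -> computable g -> computable h ->
    computable (fun n => comp E (f n) (g n) (h n) : nat).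
  apply: (@computable_app3 (fun t n u => comp E t n u : nat)).
  apply: computable_has; computability.
  by apply: computable_app2 => //; computability.
have hinj f g h : computable f -> computable g -> computable h ->
    computable (fun n => injured E (f n) (g n) (h n) : nat).
  apply: (@computable_app3 (fun t n u => injured E t n u : nat)).
  apply: computable_all; computability; last by apply: hbend; computability.
  by apply: hcomp; computability; apply: computable_mod; computability.
have hcand : computable (fun z => cand E (nfst z) (nfst (nsnd z))
    (nfst (nsnd (nsnd z))) (nsnd (nsnd (nsnd z))) : nat).
  apply: computable_has; computability.
  - by apply: computable_bit; computability.
  - by apply: hbend; computability.
  - by apply: hinj; computability.
  - by apply: computable_bit; computability.
  - apply: computable_all; last by apply: hbend; computability.
    by computability; apply: computable_bit; computability.
have hchg f g h : computable f -> computable g -> computable h ->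
    computable (fun n => find (cand E (f n) (g n) (h n)) (iota 0 (bend (f n)))).
  apply: (@computable_app3 (fun t w M => find (cand E t w M) (iota 0 (bend t)))).
  apply: computable_find; last by apply: hbend; computability.
  apply: computable_ext (computable_comp hcand (g := fun z =>
    npair (nfst (nfst z)) (npair (nfst (nsnd (nfst z)))
      (npair (nsnd (nsnd (nfst z))) (nsnd z)))) _) => [z|].
    by rewrite !nsnd_pair !nfst_pair.
  by computability.
have hnext : computable (fun z => next E (nfst z) (nsnd z)).
  rewrite /next; computability.
  all: try by apply: hbend; computability.
  all: try by apply: hchg; computability.
  all: try by apply: computable_mod; computability; apply: hchg; computability.
  apply: computable_all; computability; first by apply: computable_bit; computability.
  by apply: hbend; computability.
rewrite /word /run; computability.
by apply: computable_app2 => //; computability.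
Qed.

(** * Descriptions *)

Lemma eval_functional c n m m' : eval c n m -> eval c n m' -> m = m'.
Proof.
have [E [_ hE hmono]] := approximable c.
move=> /hE [k e] /hE [k' e'].
have := hmono _ _ _ _ (leq_maxl k k') e.
by rewrite (hmono _ _ _ _ (leq_maxr k k') e') => -[].
Qed.

(* The machine that maps the empty string to t and is undefined elsewhere is
   prefix-free. *)
Lemma optimal_describes U t : optimal_machine U -> exists s, U s = Some t.
Proof.
move=> [_ opt].
pose M (s : seq bool) := if s == [::] then Some t else None.
suff pM : prefix_free_machine M.
  have [c hc] := opt M pM; have [s e _] := hc [::] t erefl.
  by exists s.
split; last first.
  by move=> s s'; rewrite /M; case: eqP => // -> _; case: eqP => // ->.
(* Minimisation over [F] halts exactly on 0, the code of the empty string, and returns the code of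
   [t]. *)
pose F z := ~~ ((nfst z == 0) && (nsnd z == strcode t)) : nat.
have [d hd] : computable F by rewrite /F; computability.
have dP z y : eval d z y <-> y = F z.
  by split=> [h|->] //; exact: eval_functional h (hd z).
exists (cmu d) => s m; split.
  move=> [/dP + _]; rewrite /F nfst_pair nsnd_pair => /esym/eqP.
  rewrite eqb0 negbK => /andP[/eqP s0 /eqP ->].
  by exists t => //; rewrite /M (@strcode_inj s [::]).
rewrite /M; case: eqP => [->|_ [//]] [_ [<-] ->]; split.
  by apply/dP; rewrite /F nfst_pair nsnd_pair !eqxx.
move=> i lt; exists 0; apply/dP; rewrite /F nfst_pair nsnd_pair eqxx /=.
by rewrite ltn_eqF.
Qed.

(** Some description of [t] exists, so [K U t] is the length of an actual description and not the
    default 0. *)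
Lemma ltn_K U t n : optimal_machine U ->
  (forall p, size p <= n -> U p <> Some t) -> n < K U t.
Proof.
move=> hU hn; have [s0 hs0] := optimal_describes t hU.
pose D k := `[< exists2 s, U s = Some t & size s = k >].
have exD : exists k, D k by exists (size s0); apply/asboolP; exists s0.
case: (ex_minnP exD) => k /asboolP hk mk.
have : exists k, (exists2 s, U s = Some t & size s = k) /\
    (forall s, U s = Some t -> k <= size s).
  exists k; split=> // s hs; apply: mk; apply/asboolP; exists s => //.
move=> /(xgetPex 0) [[s hs es] _].
rewrite /K -es ltnNge; apply/negP => /hn; exact.
Qed.

Lemma comp_describes c E U n u : approximates E c ->
  (forall s m, eval c (strcode s) m <-> exists2 t, U s = Some t & m = strcode t) ->
  u < 2 ^ n -> (exists t, comp E t n u) <->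
  exists2 p, size p <= n & U p = Some (mkseq (bit u) n).
Proof.
move=> [_ hE _] hc un.
have code_u : (strcode (mkseq (bit u) n)).+1 = 2 ^ n + u.
  by rewrite strcode_bits modn_small.
split.
  move=> [t /hasP[q + /eqP e]]; move: e; have [p <-] := strcode_surj q => e.
  rewrite mem_iota /= add0n => pn; exists p.
    by rewrite -strcode_ltn; lia.
  have /hc [s -> /strcode_inj -> //] :
      eval c (strcode p) (strcode (mkseq (bit u) n)).
    by apply/hE; exists t; rewrite code_u.
move=> [p pn Up]; have /hE [t e] : eval c (strcode p) (strcode (mkseq (bit u) n)).
  by apply/hc; exists (mkseq (bit u) n).
exists t; apply/hasP; exists (strcode p); last by rewrite e code_u.
by move: pn; rewrite -strcode_ltn mem_iota; lia.
Qed.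

Lemma unbounded_infinite (A : set nat) :
  (forall N, exists2 n, N <= n & A n) -> infinite_set A.
Proof.
move=> h /finite_seqP [s As]; have [n le] := h (\max_(i <- s) i).+1.
rewrite As /= => ns; have := @leq_bigmax_seq _ s xpredT id n ns isT.
by rewrite leqNgt le.
Qed.

Lemma infinite_unbounded (A : set nat) :
  infinite_set A -> forall N, exists2 n, N <= n & A n.
Proof.
move=> infA N; apply: contrapT => nex; apply: infA.
apply: (@sub_finite_set _ _ `I_N); last exact: finite_II.
by move=> n An /=; rewrite ltnNge; apply/negP => le; apply: nex; exists n.
Qed.

Local Open Scope classical_set_scope.
Local Open Scope ring_scope.

(** * Binary expansions *)

Section BinaryExpansion.
Variable R : realType.
Implicit Types c : nat -> bool.

Definition psum c : R^nat := series (fun k => (c k)%:R / 2 ^+ k.+1).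
Definition bin_val c : R := limn (psum c).

Lemma psumS c n : psum c n.+1 = psum c n + (c n)%:R / 2 ^+ n.+1.
Proof. by rewrite /psum /series /= big_nat_recr. Qed.

Lemma psum_eq c c' n : (forall j, (j < n)%N -> c j = c' j) -> psum c n = psum c' n.
Proof.
by move=> h; rewrite /psum /series /=; apply: eq_big_nat => j /andP[_ /h ->].
Qed.

Lemma half_exp n : 2 ^- n = 2 ^- n.+1 + 2 ^- n.+1 :> R.
Proof. by rewrite exprS invfM; lra. Qed.

Lemma psum_bounds c n m :
  psum c n <= psum c (n + m)%N <= psum c n + 2 ^- n - 2 ^- (n + m)%N.
Proof.
elim: m => [|m /andP[IH1 IH2]]; first by rewrite addn0 addrK !lexx.
rewrite addnS psumS; have := half_exp (n + m)%N.
have : 0 < 2 ^- (n + m)%N.+1 :> R by rewrite invr_gt0 exprn_gt0.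
by move: IH1 IH2; case: (c _); rewrite ?mul1r ?mul0r => *; apply/andP; split; lra.
Qed.

Lemma psum_le c n m : (n <= m)%N -> psum c n <= psum c m.
Proof. by move=> h; rewrite -(subnKC h); case/andP: (psum_bounds c n (m - n)%N). Qed.

Lemma psum_ub c n m : psum c m <= psum c n + 2 ^- n.
Proof.
case: (leqP n m) => h.
  rewrite -(subnKC h); have /andP[_ le] := psum_bounds c n (m - n)%N.
  by apply: le_trans le _; rewrite gerBl invr_ge0 exprn_ge0.
by apply: le_trans (psum_le c (ltnW h)) _; rewrite lerDl invr_ge0 exprn_ge0.
Qed.

Lemma psum_cvg c : cvgn (psum c).
Proof.
apply: nondecreasing_is_cvgn; first by move=> n m; exact: psum_le.
by exists (psum c 0 + 2 ^- 0) => _ [m _ <-]; exact: psum_ub.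
Qed.

Lemma bin_val_bounds c n : psum c n <= bin_val c <= psum c n + 2 ^- n.
Proof.
apply/andP; split.
  by apply: limr_ge; [exact: psum_cvg | exists n => // m /= /psum_le].
by apply: limr_le; [exact: psum_cvg | near=> m; exact: psum_ub].
Unshelve. all: by end_near.
Qed.

Lemma bin_val_close c c' n : (forall j, (j < n)%N -> c j = c' j) ->
  `|bin_val c - bin_val c'| <= 2 ^- n.
Proof.
move=> /psum_eq e; have := bin_val_bounds c n; have := bin_val_bounds c' n.
by rewrite e => /andP[h1 h2] /andP[h3 h4]; rewrite ler_norml; apply/andP; split; lra.
Qed.

(** The digits of [c] after [k] are worth at most [2 ^- k.+1] together, which is the weight of digit
    [k] in [c']. *)
Lemma bin_val_lex c c' k : (forall j, (j < k)%N -> c j = c' j) ->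
  ~~ c k -> c' k -> bin_val c <= psum c' k.+1.
Proof.
move=> /psum_eq e nc c1; have /andP[_ h] := bin_val_bounds c k.+1.
apply: le_trans h _; rewrite !psumS e (negbTE nc) c1 mul0r mul1r.
by rewrite addr0.
Qed.

Lemma bin_val_gt_psum c n : (exists2 k, (n <= k)%N & c k) -> psum c n < bin_val c.
Proof.
move=> [k nk ck]; have /andP[h _] := bin_val_bounds c k.+1.
apply: lt_le_trans h; rewrite psumS ck mul1r.
by apply: le_lt_trans (psum_le c nk) _; rewrite ltrDl invr_gt0 exprn_gt0.
Qed.

Lemma bin_val_finite c n : (forall j, (n <= j)%N -> c j = false) ->
  bin_val c = psum c n.
Proof.
move=> h; apply: cvg_lim => //.
apply: cvg_near_cst; exists n => // m /= nm.
by rewrite -(subnKC nm); elim: (m - n)%N => [|k IH]; rewrite ?addn0 // addnS psumS IH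
  h ?leq_addr // mul0r addr0.
Qed.

(** At the first difference, the sequence with digit 1 has further ones, which make the inequality
    of [bin_val_lex] strict. *)
Lemma bin_val_inj c c' : infinite_set [set k | c k] -> infinite_set [set k | c' k] ->
  bin_val c = bin_val c' -> c = c'.
Proof.
move=> /infinite_unbounded ic /infinite_unbounded ic' e; apply/funext => n.
have [h|[k _ [ne h]]] := first_difference c c' n.+1; first by rewrite h.
have strict d d' : (forall j, (j < k)%N -> d j = d' j) -> ~~ d k -> d' k ->
    (forall N, exists2 n, (N <= n)%N & d' n) -> bin_val d < bin_val d'.
  move=> hd h1 h2 inf; apply: le_lt_trans (bin_val_lex hd h1 h2) _.
  exact/bin_val_gt_psum/inf.
exfalso; case ck: (c k) ne; case ck': (c' k) => // _.
  suff : bin_val c' < bin_val c by rewrite e ltxx.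
  by apply: strict => [j /h|||] //; rewrite ?ck ?ck'.
suff : bin_val c < bin_val c' by rewrite e ltxx.
by apply: strict => [j /h|||] //; rewrite ?ck ?ck'.
Qed.

Lemma binary_sequence_bin_val c : infinite_set [set k | c k] ->
  binary_sequence (bin_val c) = c.
Proof.
move=> ic.
have range (d : nat -> bool) : infinite_set [set k | d k] -> 0 < bin_val d <= 1.
  move=> /infinite_unbounded id; have := bin_val_bounds d 0.
  have := bin_val_gt_psum (id 0%N).
  by rewrite /psum /series /= big_nil expr0 invr1 add0r => -> /andP[_ ->].
have : exists b : nat -> bool, infinite_set [set k | b k] /\
    exists y : R, [/\ 0 < y <= 1, bin_val c - y \is a Num.int
                    & is_binary_representation b y].
  exists c; split=> //; exists (bin_val c); split; first exact: range.
    by rewrite subrr.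
  exact: psum_cvg.
move=> /(xgetPex (fun=> false)); rewrite -/(binary_sequence _).
move: (binary_sequence _) => d [id [y [hy iy yd]]].
have ey : y = bin_val d by apply/esym/cvg_lim.
apply: bin_val_inj => //; rewrite -ey.
(* Two points of the interval (0, 1] that differ by an integer are equal. *)
have /andP[h1 h2] := range c ic; case/andP: hy => h3 h4.
move: iy => /intrP [z ez]; have : `|bin_val c - y| < 1.
  by rewrite ltr_norml; apply/andP; split; lra.
rewrite ez -intr_norm ltrz1 => zz.
have z0 : z = 0 by lia.
by move: ez; rewrite z0 => /eqP; rewrite subr_eq0 => /eqP.
Qed.

End BinaryExpansion.

(** * The rational approximations and the conclusion *)

Definition rev_bits (w n : nat) : nat :=
  prec 0 (fun i r => (r + r + bit w i)%N) n.

Lemma psum_bits (R : realType) w n :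
  psum R (bit w) n = (rev_bits w n)%:R / (2 ^ n)%N%:R.
Proof.
elim: n => [|n IH]; first by rewrite /psum /series /= big_nil mul0r.
rewrite psumS IH /rev_bits precS -/(rev_bits w n) !natrD expnS natrM natrX exprS.
have : (2 : R) ^+ n != 0 by rewrite expf_neq0.
by move=> h; field.
Qed.

Theorem theorem6p2 (R : realType) (U : seq bool -> option (seq bool))
    (hU : optimal_machine U) :
  exists alpha : R,
    [/\ 0 < alpha < 1, regainingly_approximable alpha
      & infinite_set [set n : nat | (n < K U (restrict_bits alpha n))%N]].
Proof.
have [[[c hc] U_prefix] _] := hU; have [E hE] := approximable c.
have [E_comp _ E_mono] := hE.
have compP n u := @comp_describes c E U n u hE hc.
have [b b_lim] := word_lim E.
have ib : infinite_set [set k | b k].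
  exact/unbounded_infinite/(lim_ones b_lim).
pose alpha := bin_val R b; exists alpha.
have prefix_alpha n : restrict_bits alpha n = mkseq b n.
  by rewrite /restrict_bits binary_sequence_bin_val.
split.
(* Digit 0 vanishes, so [alpha] is at most 1/2; some digit is 1, so it is positive. *)
- have b0 := lim_head b_lim.
  have := bin_val_gt_psum R (lim_ones b_lim 0).
  have := bin_val_bounds R b 1; rewrite -/alpha psumS b0 mul0r addr0.
  rewrite /psum /series /= big_nil add0r expr1 => /andP[_ h1 ->] /=.
  by apply: le_lt_trans h1 _; lra.
(* Digits from [bend t] on are 0, so this fraction is exact; its denominator [2 ^ bend t] is put in
   the successor form of [computable_rat_seq]. *)
- pose a t : rat := ((rev_bits (word E t) (bend t))%:R - 0%N%:R)
    / ((2 ^ bend t).-1).+1%:R.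
  have aE t : ratr (a t) = bin_val R (bit (word E t)).
    rewrite (@bin_val_finite R _ (bend t)) => [|j]; last exact: word_supp.
    rewrite psum_bits /a prednK ?expn_gt0 // subr0.
    by rewrite fmorph_div /= !ratr_nat.
  have word_comp := computable_word E_comp.
  exists a; split.
  + exists (fun t => rev_bits (word E t) (bend t)), (fun=> 0%N),
      (fun t => (2 ^ bend t).-1)%N; split=> //.
    * rewrite /rev_bits /bend; computability.
      apply: computable_bit; computability.
      by apply: computable_comp => //; computability.
    * exact: computable_const.
    * by rewrite /bend; computability.
  + have a_step t : a t <= a t.+1.
      rewrite -(ler_rat R) !aE.
      have [-> //|[k [h1 h2 h3]]] := word_increases E t.
      apply: le_trans (bin_val_lex R _ h2 h3) _; first by move=> j /h1.
      by case/andP: (bin_val_bounds R (bit (word E t.+1)) k.+1).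
    exact/nondecreasing_seqP.
  + apply/cvgrPdist_le => e e0.
    have [m _ /(_ m (leqnn m)) /= hm] := near_infty_natSinv_expn_lt (PosNum e0).
    have [T hT] := b_lim m; exists T => // t /= Tt; rewrite aE.
    apply: (@le_trans _ _ (2 ^- m)); last by rewrite -[leLHS]div1r ltW.
    by apply: bin_val_close => j jm; rewrite hT.
  (* At a true stage the digits up to and including [T] are final: these are [T.+1] digits, and the
     error bound [2 ^- T.+1] is strictly below [2 ^- T]. *)
  + apply: unbounded_infinite => N; have [T NT hT] := lim_true_stage b_lim N.
    exists T => //=; rewrite aE.
    have close : `|alpha - bin_val R (bit (word E T))| <= 2 ^- T.+1.
      by apply: bin_val_close => j jT; rewrite hT.
    have lt : 2 ^- T.+1 < 2 ^- T :> R.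
      by rewrite (half_exp R T) ltrDl invr_gt0 exprn_gt0.
    exact: le_lt_trans (le_trans (ler_norm _) close) lt.
- apply: unbounded_infinite => N.
  have [n Nn hn] := lim_incompressible E_mono U_prefix compP b_lim N.
  by exists n => //=; rewrite prefix_alpha; exact: ltn_K.
Qed.
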